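(* Let $n,k\ge 1$ and let $\mathbf{C}=(C_0,C_1,\dots,C_k)$ be a $(k+1)$-tuple of real $n\times n$ matrices. If $\mathbf{C}$ has the column sufficient-$W$ (cS-$W$) property, then the solution set $\mathrm{SOL}(\mathbf{C},\mathbf{d},q)$ of $\mathrm{EHLCP}(\mathbf{C},\mathbf{d},q)$ is convex for every $q\in\mathbb{R}^n$ and every $\mathbf{d}=(d_1,\dots,d_{k-1})$ with all $d_j\in\mathbb{R}^n_{++}$.
   Context: Notation: $[m]=\{1,\dots,m\}$; $\mathbb{R}^n_{++}$ is the set of vectors in $\mathbb{R}^n$ with all entries positive; for $u,v\in\mathbb{R}^n$, $u*v$ is the componentwise product, $u\wedge v$ is the componentwise minimum, and $u\ge 0$, $u\le 0$ are understood componentwise. cS-$W$ property: $\mathbf{C}=(C_0,\dots,C_k)$ has the cS-$W$ property if for all $x_0,x_1,\dots,x_k\in\mathbb{R}^n$ with $C_0x_0=\sum_{i=1}^k C_ix_i$, $x_0*x_i\le 0$ for all $i\in[k]$, and $x_i*x_j\ge 0$ for all $1\le i<j\le k$, one has $x_i*x_{i+1}=0$ for all $0\le i\le k-1$. EHLCP: for $q\in\mathbb{R}^n$ and $\mathbf{d}=(d_1,\dots,d_{k-1})$ with $d_j\in\mathbb{R}^n_{++}$ (empty tuple if $k=1$), $\mathrm{EHLCP}(\mathbf{C},\mathbf{d},q)$ is the problem of finding $(x_0,x_1,\dots,x_k)\in(\mathbb{R}^n)^{k+1}$ such that $C_0x_0=q+\sum_{i=1}^kC_ix_i$, $x_0\wedge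 x_1=0$, and $(d_j-x_j)\wedge x_{j+1}=0$ for all $j\in[k-1]$. $\mathrm{SOL}(\mathbf{C},\mathbf{d},q)\subseteq(\mathbb{R}^n)^{k+1}$ denotes the set of all its solutions (possibly empty). *)

(* Defs.v *)
From HB Require Import structures.
From mathcomp Require Import all_boot all_order all_algebra.
From mathcomp Require Import boolp classical_sets reals convex.

Set Implicit Arguments.
Unset Strict Implicit.
Unset Printing Implicit Defensive.
Import Order.TTheory GRing.Theory Num.Theory.

Local Open Scope classical_set_scope.
Local Open Scope ring_scope.

Definition hadamard (R : realType) (n : nat) (u v : 'cV[R]_n) : 'cV[R]_n :=
  map2_mx *%R u v.

Definition vmin (R : realType) (n : nat) (u v : 'cV[R]_n) : 'cV[R]_n :=
  map2_mx Num.min u v.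

Definition vnonneg (R : realType) (n : nat) (u : 'cV[R]_n) : Prop :=
  forall a : 'I_n, 0 <= u a 0.

Definition vnonpos (R : realType) (n : nat) (u : 'cV[R]_n) : Prop :=
  forall a : 'I_n, u a 0 <= 0.

Definition vpos (R : realType) (n : nat) (u : 'cV[R]_n) : Prop :=
  forall a : 'I_n, 0 < u a 0.

(* Tuples (C_0, ..., C_k) and (x_0, ..., x_k) are indexed by 'I_k.+1; finite
   functions are used for x so that (R^n)^(k+1) is an lmodType. *)
Definition cSW (R : realType) (n k : nat) (C : 'I_k.+1 -> 'M[R]_n) : Prop :=
  forall x : {ffun 'I_k.+1 -> 'cV[R]_n},
    C ord0 *m x ord0 = \sum_(i < k.+1 | (0 < i)%N) C i *m x i ->
    (forall i : 'I_k.+1, (0 < i)%N -> vnonpos (hadamard (x ord0) (x i))) ->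
    (forall i j : 'I_k.+1, (0 < i < j)%N -> vnonneg (hadamard (x i) (x j))) ->
    forall i : 'I_k, hadamard (x (inord i)) (x (inord i.+1)) = 0.

(* The tuple (d_1, ..., d_(k-1)) is indexed from 0: d j stands for d_(j+1),
   so it is compared with x_(j+1) and x_(j+2).  For 0 < k every inord below is
   applied to an index that is at most k, so no default value occurs. *)
Definition SOL (R : realType) (n k : nat) (C : 'I_k.+1 -> 'M[R]_n)
    (d : 'I_k.-1 -> 'cV[R]_n) (q : 'cV[R]_n) :
    set {ffun 'I_k.+1 -> 'cV[R]_n} :=
  [set x | [/\ C ord0 *m x ord0 = q + \sum_(i < k.+1 | (0 < i)%N) C i *m x i,
              vmin (x ord0) (x (inord 1)) = 0
            & forall j : 'I_k.-1,
                vmin (d j - x (inord j.+1)) (x (inord j.+2)) = 0]].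

(* Main.v *)
Require Import Defs.
From HB Require Import structures.
From mathcomp Require Import all_boot all_order all_algebra.
From mathcomp Require Import boolp classical_sets reals convex.
From mathcomp Require Import ring.

(** Fix a coordinate a and read the entries (x_0)_a, ..., (x_k)_a of a solution
    as the sequence s = (- (x_0)_a, (x_1)_a, ..., (x_k)_a).  With c_0 = 0 and
    c_j = (d_j)_a for 0 < j < k, all complementarity conditions take the single
    form min (c_j - s_j, s_(j+1)) = 0: the entry s_(j+1) can leave 0 only
    after s_j has reached its bound c_j.  As the bounds c_j with j > 0 are
    positive, such a sequence is saturated below any of its positive entries
    ([chain_saturated]), so that these sequences form a monotone curve: of two
    of them, one dominates the other in every entry, and their differences at
    two indices never have opposite signs ([chain_comonotone]).

    Hence the difference z = x - y of two solutions satisfies the sign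
    conditions of the cS-W property, the flipped sign of x_0 turning >= into
    <=, and it solves the homogeneous linear equation.  Therefore
    z_i * z_(i+1) = 0 for all i.  This is exactly what makes complementarity
    stable under convex combinations ([minr_eq0_conv]): when u v = u' v' = 0, the
    product (a u + b u') (a v + b v') equals - a b (u - u') (v - v'). *)

Set Implicit Arguments.
Unset Strict Implicit.
Unset Printing Implicit Defensive.
Import Order.TTheory GRing.Theory Num.Theory.

Local Open Scope ring_scope.

Lemma minr_eq0P (R : realDomainType) (u v : R) :
  Num.min u v = 0 <-> [/\ 0 <= u, 0 <= v & u * v = 0].
Proof.
split=> [m0|[u0 v0 /eqP]].
- have u0 : 0 <= u by rewrite -m0 ge_min lexx.
  have v0 : 0 <= v by rewrite -m0 ge_min lexx orbT.
  split=> //; move: m0; case: leP => _ ->; by rewrite ?mul0r ?mulr0.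
- by rewrite mulf_eq0 => /orP[] /eqP ->; [exact: min_l | exact: min_r].
Qed.

Lemma minr_eq0_conv (R : realDomainType) (a b u v u' v' : R) :
  0 <= a -> 0 <= b -> Num.min u v = 0 -> Num.min u' v' = 0 ->
  (u - u') * (v - v') = 0 ->
  Num.min (a * u + b * u') (a * v + b * v') = 0.
Proof.
move=> a0 b0 /minr_eq0P[u0 v0 uv] /minr_eq0P[u0' v0' uv'] z.
apply/minr_eq0P; split; [by rewrite addr_ge0 ?mulr_ge0.. |].
have -> : (a * u + b * u') * (a * v + b * v') =
  a * (a + b) * (u * v) + b * (a + b) * (u' * v')
  - a * b * ((u - u') * (v - v')) by ring.
by rewrite uv uv' z !mulr0 addr0 subr0.
Qed.

(** [s] lists x_0, ..., x_k at one coordinate, with x_0 negated, and [c] the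
    bounds, with c 0 = 0 in the intended use. *)
Definition chain (R : realDomainType) (k : nat) (c s : nat -> R) : Prop :=
  forall j, (j < k)%N -> Num.min (c j - s j) (s j.+1) = 0.

(** By descending induction: a positive entry forces the previous one to equal
    its bound, and that bound is again positive unless it has index 0. *)
Lemma chain_saturated (R : realDomainType) (k : nat) (c s : nat -> R) (i j : nat) :
  (forall l, (0 < l < k)%N -> 0 < c l) -> chain k c s ->
  (i < j <= k)%N -> 0 < s j -> s i = c i.
Proof.
move=> c_gt0 chs; elim: j => [|j IHj] // /andP[lt_ij lt_jk] sj_gt0.
have sjE : s j = c j.
  have /minr_eq0P[_ _ /eqP] := chs _ lt_jk.
  by rewrite mulf_eq0 (gt_eqF sj_gt0) orbF subr_eq0 => /eqP.
move: lt_ij; rewrite ltnS leq_eqVlt => /predU1P[-> // | lt_ij].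
apply: IHj; first by rewrite lt_ij ltnW.
by rewrite sjE c_gt0 // lt_jk (leq_ltn_trans _ lt_ij).
Qed.

(** If s is ahead of t at j, then s j > 0, so s is saturated at i < j, where t
    is at most the bound. *)
Lemma chain_comonotone (R : realDomainType) (k : nat) (c s t : nat -> R) (i j : nat) :
  (forall l, (0 < l < k)%N -> 0 < c l) -> chain k c s -> chain k c t ->
  (i < j <= k)%N -> 0 <= (s i - t i) * (s j - t j).
Proof.
move=> c_gt0; wlog le_ts : s t / t j <= s j => [hwlog | ] chs cht lt_ijk.
  case: (leP (t j) (s j)) => [|/ltW] le; first exact: hwlog.
  by rewrite -mulrNN !opprB; exact: hwlog.
move: le_ts; rewrite le_eqVlt => /predU1P[-> | lt_ts].
  by rewrite subrr mulr0.
have /andP[lt_ij le_jk] := lt_ijk.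
have tj_ge0 : 0 <= t j.
  case: j lt_ij le_jk {lt_ijk lt_ts} => // j _ lt_jk.
  by have /minr_eq0P[] := cht _ lt_jk.
rewrite (chain_saturated c_gt0 chs lt_ijk (le_lt_trans tj_ge0 lt_ts)).
have /minr_eq0P[ti_le _ _] := cht _ (leq_trans lt_ij le_jk).
by rewrite mulr_ge0 // subr_ge0 ltW.
Qed.

Lemma chain_conv (R : realDomainType) (k : nat) (c s t : nat -> R) (a b : R) :
  0 <= a -> 0 <= b -> a + b = 1 -> chain k c s -> chain k c t ->
  (forall j, (j < k)%N -> (s j - t j) * (s j.+1 - t j.+1) = 0) ->
  chain k c (fun j => a * s j + b * t j).
Proof.
move=> a0 b0 ab1 chs cht z j lt_jk.
have -> : c j - (a * s j + b * t j) = a * (c j - s j) + b * (c j - t j).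
  by rewrite -[c j in LHS]mul1r -ab1; ring.
apply: minr_eq0_conv (chs _ lt_jk) (cht _ lt_jk) _ => //.
have -> : c j - s j - (c j - t j) = - (s j - t j) by ring.
by rewrite mulNr z // oppr0.
Qed.

Definition entries (R : realType) (n k : nat) (x : {ffun 'I_k.+1 -> 'cV[R]_n})
    (a : 'I_n) (j : nat) : R :=
  if j is 0 then - x ord0 a 0 else x (inord j) a 0.

(** The bound at j > 0 is d_j; since [d] is indexed from 0, it is stored at
    j - 1.  The default value 0 is reached only for j >= k. *)
Definition bounds (R : realType) (n k : nat) (d : 'I_k.-1 -> 'cV[R]_n)
    (a : 'I_n) (j : nat) : R :=
  if j is j'.+1 then oapp (fun o => d o a 0) 0 (insub j') else 0.

Lemma bounds_gt0 (R : realType) (n k : nat) (d : 'I_k.-1 -> 'cV[R]_n) (a : 'I_n) :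
  (forall j, vpos (d j)) -> forall l, (0 < l < k)%N -> 0 < bounds d a l.
Proof.
case: k d => [|k] d hd [|l] //=; rewrite ltnS => lt_lk.
by rewrite insubT /=; exact: hd.
Qed.

Lemma entriesB (R : realType) (n k : nat) (x y : {ffun 'I_k.+1 -> 'cV[R]_n})
    (a : 'I_n) (j : nat) :
  entries (x - y) a j = entries x a j - entries y a j.
Proof. by case: j => [|j] /=; rewrite !ffunE !mxE ?opprD. Qed.

Lemma entries_conv (R : realType) (n k : nat) (x y : {ffun 'I_k.+1 -> 'cV[R]_n})
    (u v : R) (a : 'I_n) (j : nat) :
  entries (u *: x + v *: y) a j = u * entries x a j + v * entries y a j.
Proof. by case: j => [|j] /=; rewrite !ffunE !mxE //; ring. Qed.

Lemma entries_gt0 (R : realType) (n k : nat) (x : {ffun 'I_k.+1 -> 'cV[R]_n})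
    (a : 'I_n) (i : 'I_k.+1) :
  (0 < i)%N -> entries x a i = x i a 0.
Proof.
by rewrite /entries; case Ei: (nat_of_ord i) => [|j] // _; rewrite -Ei inord_val.
Qed.

(** This is where the -x_0 of [entries] and the bound 0 at index 0 pay off: the
    condition on (x_0, x_1) is the case j = 0 of the conditions on
    (x_j, x_(j+1)). *)
Lemma SOL_chainP (R : realType) (n k : nat) (C : 'I_k.+1 -> 'M[R]_n)
    (d : 'I_k.-1 -> 'cV[R]_n) (q : 'cV[R]_n) (x : {ffun 'I_k.+1 -> 'cV[R]_n}) :
  (0 < k)%N ->
  SOL C d q x <->
  C ord0 *m x ord0 = q + \sum_(i < k.+1 | (0 < i)%N) C i *m x i /\
  forall a, chain k (bounds d a) (entries x a).
Proof.
case: k C d x => [|k] C d x //= _; split=> [[lin x01 xd] | [lin chx]]; split=> //.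
- move=> a [_|j] /=.
    by move/matrixP: x01 => /(_ a 0); rewrite !mxE sub0r opprK.
  rewrite ltnS => lt_jk; move/matrixP: (xd (Ordinal lt_jk)) => /(_ a 0).
  by rewrite insubT !mxE.
- apply/matrixP => a b; rewrite ord1 !mxE.
  by have := chx a 0 isT; rewrite /= sub0r opprK.
- move=> j; apply/matrixP => a b; rewrite ord1 !mxE.
  by have := chx a j.+1 (ltn_ord j); rewrite /= valK.
Qed.

(** The difference of two solutions satisfies the hypotheses of the cS-W
    property, the sign conditions coming from [chain_comonotone]. *)
Lemma SOL_sub_adjacent (R : realType) (n k : nat) (C : 'I_k.+1 -> 'M[R]_n)
    (d : 'I_k.-1 -> 'cV[R]_n) (q : 'cV[R]_n) (x y : {ffun 'I_k.+1 -> 'cV[R]_n}) :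
  (0 < k)%N -> cSW C -> (forall j, vpos (d j)) -> SOL C d q x -> SOL C d q y ->
  forall a j, (j < k)%N ->
  (entries x a j - entries y a j) * (entries x a j.+1 - entries y a j.+1) = 0.
Proof.
move=> k_gt0 hC hd /(SOL_chainP _ _ _ _ k_gt0)[linx chx].
move=> /(SOL_chainP _ _ _ _ k_gt0)[liny chy] a j lt_jk.
have comon b i l : (i < l <= k)%N -> 0 <= entries (x - y) b i * entries (x - y) b l.
  by rewrite !entriesB; exact: chain_comonotone (bounds_gt0 b hd) (chx b) (chy b).
have linz : C ord0 *m (x - y) ord0 = \sum_(i < k.+1 | (0 < i)%N) C i *m (x - y) i.
  rewrite !ffunE mulmxDr mulmxN linx liny opprD addrACA subrr add0r -sumrB.
  by apply: eq_bigr => i _; rewrite !ffunE mulmxDr mulmxN.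
have signs0 (i : 'I_k.+1) : (0 < i)%N -> vnonpos (hadamard ((x - y) ord0) ((x - y) i)).
  move=> i_gt0 b; rewrite mxE -oppr_ge0 -mulNr -(entries_gt0 (x - y) b i_gt0).
  by apply: (comon b 0%N i); rewrite i_gt0 -ltnS ltn_ord.
have signs (i l : 'I_k.+1) :
    (0 < i < l)%N -> vnonneg (hadamard ((x - y) i) ((x - y) l)).
  move=> /andP[i_gt0 lt_il] b; have l_gt0 := ltn_trans i_gt0 lt_il.
  rewrite mxE -(entries_gt0 _ b i_gt0) -(entries_gt0 _ b l_gt0).
  by apply: comon; rewrite lt_il -ltnS ltn_ord.
have /matrixP/(_ a 0) := hC _ linz signs0 signs (Ordinal lt_jk).
rewrite -!entriesB !mxE /=; case: j lt_jk => [|j] //= _.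
have -> : inord 0 = ord0 :> 'I_k.+1 by apply/val_inj; rewrite /= inordK.
by rewrite mulNr => ->; rewrite oppr0.
Qed.

Theorem theorem3p2 (R : realType) (n k : nat) (n_gt0 : (0 < n)%N)
    (k_gt0 : (0 < k)%N) (C : 'I_k.+1 -> 'M[R]_n) (hC : cSW C)
    (q : 'cV[R]_n) (d : 'I_k.-1 -> 'cV[R]_n) (hd : forall j, vpos (d j)) :
  convex_set (SOL C d q).
Proof.
apply/convex_setW => x y; rewrite !inE => solx soly t t_gt0 t_lt1.
rewrite inE.
have adj := SOL_sub_adjacent k_gt0 hC hd solx soly.
move: solx soly => /(SOL_chainP _ _ _ _ k_gt0)[linx chx].
move=> /(SOL_chainP _ _ _ _ k_gt0)[liny chy].
set u : R := interval_inference.Itv.r t in t_gt0 t_lt1 *.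
rewrite -[conv t x y]/(u *: (x : {ffun _ -> _}) + (1 - u) *: (y : {ffun _ -> _})).
have uv1 : u + (1 - u) = 1 by rewrite addrC subrK.
apply/(SOL_chainP _ _ _ _ k_gt0); split=> [|a].
- rewrite !ffunE mulmxDr -!scalemxAr linx liny !scalerDr addrACA -scalerDl.
  rewrite uv1 scale1r; congr (_ + _).
  rewrite !scaler_sumr -big_split; apply: eq_bigr => i _ /=.
  by rewrite !ffunE mulmxDr -!scalemxAr.
- have u_ge0 : 0 <= u by exact: ltW.
  have v_ge0 : 0 <= 1 - u by rewrite subr_ge0 ltW.
  have chc := chain_conv u_ge0 v_ge0 uv1 (chx a) (chy a) (adj a).
  by move=> j lt_jk; rewrite !entries_conv; exact: chc.
Qed.
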